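(* Let $Gr(2,4)$ be the Grassmannian of $2$-planes in $\mathbb R^4$ and let $$W=\{([\pi_1],[\pi_2])\in Gr(2,4)\times Gr(2,4)\ |\ \pi_1\wedge\pi_2=0\}.$$ Away from the diagonal $\{([\pi],[\pi])\}$, $W$ is a smooth hypersurface of $Gr(2,4)\times Gr(2,4)$.
   Context: $Gr(2,4)$ is viewed, via the Plücker embedding, as the set of classes $[\pi]\in\mathbb P(\Lambda^2\mathbb R^4)$ of nonzero bivectors $\pi$ with $\pi\wedge\pi=0$ (equivalently, $\pi={\bf u}\wedge{\bf v}$ is decomposable and $[\pi]$ represents the plane spanned by ${\bf u},{\bf v}$). *)

(* Defs.v *)
From HB Require Import structures.
From mathcomp Require Import all_boot all_order all_algebra.
From mathcomp Require Import all_classical all_reals all_analysis.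
From mathcomp Require Import ring.

Set Implicit Arguments.
Unset Strict Implicit.
Unset Printing Implicit Defensive.

Import Order.TTheory GRing.Theory Num.Theory.
Import numFieldNormedType.Exports.

Local Open Scope classical_set_scope.
Local Open Scope ring_scope.

(** * Smooth maps between open subsets of R^m and R^n *)

Section Smooth.
Variables (R : realType) (m n : nat).

(* Meant for open U.  In finite dimension, df is of class C^k iff all the
   directional derivatives 'D_v f are. *)
Fixpoint class_C (k : nat) (U : set 'rV[R]_m) (f : 'rV[R]_m -> 'rV[R]_n) : Prop :=
  match k with
  | 0 => forall x, U x -> {for x, continuous f}
  | k'.+1 => (forall x, U x -> differentiable f x) /\
             (forall v : 'rV[R]_m, class_C k' U ('D_v f))
  end.

Definition smooth_on (U : set 'rV[R]_m) (f : 'rV[R]_m -> 'rV[R]_n) : Prop :=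
  forall k, class_C k U f.

End Smooth.

(** * Charts, atlases, embedded submanifolds

   A manifold is a subset [M] of a type [T] with a set of charts; its topology
   is the one for which chart domains are open and charts are homeomorphisms
   onto their images.  Charts are total functions, of which only the values on
   the domain matter. *)

Record chart (R : realType) (T : Type) (n : nat) := Chart {
  cdom : set T ;
  cmap : T -> 'rV[R]_n
}.

Section Atlas.
Variables (R : realType) (T : Type) (n : nat).
Implicit Types (M S : set T) (A : set (chart R T n)) (c : chart R T n).

Definition is_chart M c : Prop :=
  [/\ cdom c `<=` M, {in cdom c &, injective (cmap c)}
    & open (cmap c @` cdom c)].

(* The transition map cmap c' \o (cmap c)^-1 is smooth between open sets;
   [g] is determined on the set where its smoothness is required. *)
Definition smooth_transition c c' : Prop :=
  let U := cdom c `&` cdom c' in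
  open (cmap c @` U) /\
  exists g : 'rV[R]_n -> 'rV[R]_n,
    smooth_on (cmap c @` U) g /\ forall p, U p -> cmap c' p = g (cmap c p).

Definition compatible c c' : Prop :=
  smooth_transition c c' /\ smooth_transition c' c.

Definition smooth_atlas M A : Prop :=
  [/\ forall c, A c -> is_chart M c,
      forall p, M p -> exists2 c, A c & cdom c p
    & forall c c', A c -> A c' -> compatible c c'].

Definition maximal_atlas M A : set (chart R T n) :=
  [set c | is_chart M c /\ forall c', A c' -> compatible c c'].

End Atlas.

Section Submanifold.
Variables (R : realType) (T : Type) (d k : nat).
Implicit Types (M S : set T) (A : set (chart R T (d + k))).

(* S is given in the chart by the vanishing of the last k coordinates. *)
Definition slice_chart M A S : set (chart R T (d + k)) :=
  [set c | maximal_atlas M A c /\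
     cmap c @` (cdom c `&` S) = cmap c @` cdom c `&` [set x | rsubmx x = 0]].

Definition embedded_submanifold M A S : Prop :=
  [/\ smooth_atlas M A, S `<=` M
    & forall p, S p -> exists2 c, slice_chart M A S c & cdom c p].

Definition sub_atlas M A S : set (chart R T d) :=
  [set Chart (cdom c `&` S) (fun p => lsubmx (cmap c p))
     | c in slice_chart M A S].

End Submanifold.

Definition smooth_hypersurface (R : realType) (T : Type) (d : nat)
    (M : set T) (A : set (chart R T (d + 1))) (S : set T) : Prop :=
  embedded_submanifold M A S.

Definition prod_chart (R : realType) (T1 T2 : Type) (m n : nat)
    (c1 : chart R T1 m) (c2 : chart R T2 n) : chart R (T1 * T2) (m + n) :=
  Chart (cdom c1 `*` cdom c2) (fun p => row_mx (cmap c1 p.1) (cmap c2 p.2)).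

Definition prod_atlas (R : realType) (T1 T2 : Type) (m n : nat)
    (A1 : set (chart R T1 m)) (A2 : set (chart R T2 n)) :
    set (chart R (T1 * T2) (m + n)) :=
  [set c | exists c1 c2, [/\ A1 c1, A2 c2 & c = prod_chart c1 c2]].

(** * Projective space: the lines of R^(n+1) *)

Section Projective.
Variables (R : realType) (n : nat).

Definition projective : set {vspace 'rV[R]_n.+1} := [set L | \dim L = 1%N].

(* The chart [v] |-> (v_j / v_i)_(j != i) on {v_i != 0}; the representative
   [vpick L] is immaterial, see [affine_chart_dom] and [affine_chart_map]. *)
Definition affine_chart (i : 'I_n.+1) : chart R {vspace 'rV[R]_n.+1} n :=
  Chart [set L | projective L /\ vpick L 0 i != 0]
        (fun L => \row_(j < n) (vpick L 0 (lift i j) / vpick L 0 i)).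

Definition projective_atlas : set (chart R {vspace 'rV[R]_n.+1} n) :=
  range affine_chart.

Lemma vpick_line (v : 'rV[R]_n.+1) : v != 0 ->
  exists2 t : R, t != 0 & vpick <[v]>%VS = t *: v.
Proof.
move=> v0; have /vlineP[t tE] := memv_pick <[v]>%VS.
exists t => //; apply: contra_neq v0 => t0.
have : vpick <[v]>%VS == 0 by rewrite tE t0 scale0r.
by rewrite vpick0 -subv0 -memvE memv0 => /eqP.
Qed.

Lemma affine_chart_dom (i : 'I_n.+1) (v : 'rV[R]_n.+1) : v != 0 ->
  cdom (affine_chart i) <[v]>%VS <-> v 0 i != 0.
Proof.
move=> v0; have [t t0 tE] := vpick_line v0.
rewrite /= /projective /= dim_vline v0 tE mxE mulf_eq0 negb_or t0 /=.
by split=> [[]|].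
Qed.

Lemma affine_chart_map (i : 'I_n.+1) (v : 'rV[R]_n.+1) : v != 0 ->
  cmap (affine_chart i) <[v]>%VS = \row_j (v 0 (lift i j) / v 0 i).
Proof.
move=> v0; have [t t0 tE] := vpick_line v0.
by apply/rowP => j; rewrite !mxE tE !mxE -mulf_div divff // mul1r.
Qed.

End Projective.

(** * Bivectors of R^4

   Elements of Lambda^2 R^4 are given by their coordinates in the basis
   e0^e1, e0^e2, e0^e3, e1^e2, e1^e3, e2^e3, and those of Lambda^4 R^4 by their
   coordinate on e0^e1^e2^e3. *)

Section Bivectors.
Variable R : realType.

Definition bivector := 'rV[R]_6.

Definition wedge (p q : bivector) : R :=
  let P k := p 0 (inord k) in let Q k := q 0 (inord k) in
  P 0%N * Q 5%N - P 1%N * Q 4%N + P 2%N * Q 3%N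
  + P 3%N * Q 2%N - P 4%N * Q 1%N + P 5%N * Q 0%N.

Definition wedge_vec (u v : 'rV[R]_4) : bivector :=
  let minor i j := u 0 (inord i) * v 0 (inord j) - u 0 (inord j) * v 0 (inord i) in
  \row_(k < 6) nth 0 [:: minor 0 1; minor 0 2; minor 0 3;
                         minor 1 2; minor 1 3; minor 2 3]%N k.

(* [wedge] is bilinear, so it is determined by its values on decomposables. *)
Lemma wedge_det (u v w z : 'rV[R]_4) :
  wedge (wedge_vec u v) (wedge_vec w z) =
  \det (\matrix_(i < 4) nth 0 [:: u; v; w; z] i).
Proof.
pose D n (f : nat -> nat -> R) := \det (\matrix_(i < n, j < n) f i j).
have D0 f : D 0%N f = 1 by exact: det_mx00.
have DS n f : D n.+1 f = \sum_(j < n.+1)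
    f 0%N j * ((-1) ^+ j * D n (fun i k => f i.+1 (bump j k))).
  rewrite /D (expand_det_row _ ord0); apply: eq_bigr => j _.
  rewrite mxE /cofactor add0n; congr (_ * (_ * \det _)).
  by apply/matrixP => i k; rewrite !mxE.
pose f i j := nth (0 : 'rV[R]_4) [:: u; v; w; z] i 0 (inord j).
have -> : \det (\matrix_(i < 4) nth 0 [:: u; v; w; z] i) = D 4 f.
  by congr (\det _); apply/matrixP => i j; rewrite !mxE /f inord_val.
do 4!rewrite !DS !big_ord_recl !big_ord0 /=.
rewrite !D0 /bump /= /f /= /wedge /wedge_vec !mxE !inordK //=.
by ring.
Qed.

(* So the points of the quadric below are exactly the classes of u ^ v. *)
Lemma wedge_self_eq0 (p : bivector) :
  wedge p p = 0 <-> exists u v : 'rV[R]_4, p = wedge_vec u v.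
Proof.
split; last by case=> u [v ->]; rewrite /wedge /wedge_vec !mxE !inordK //=; ring.
have [-> _|p0] := eqVneq p 0.
  exists 0, 0; apply/rowP => k; rewrite !mxE !mul0r subrr.
  by case: k => -[|[|[|[|[|[|]]]]]] //=.
pose P k := p 0 (inord k).
have pE k : p 0 k = P k by rewrite /P inord_val.
have : exists2 k, (k < 6)%N & P k != 0.
  move/rV0Pn: p0 => [k]; rewrite pE => h.
  by exists k.
pose vec a b c d : 'rV[R]_4 := \row_(k < 4) nth 0 [:: a; b; c; d] k.
pose r0 := vec 0 (P 0%N) (P 1%N) (P 2%N).
pose r1 := vec (- P 0%N) 0 (P 3%N) (P 4%N).
pose r2 := vec (- P 1%N) (- P 3%N) 0 (P 5%N).
pose r3 := vec (- P 2%N) (- P 4%N) (- P 5%N) 0.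
rewrite /wedge => -[k k6 Pk] h.
have {h} h : P 0%N * P 5%N = P 1%N * P 4%N - P 2%N * P 3%N.
  apply/eqP; rewrite -subr_eq0; apply/eqP; apply: (@mulfI _ 2).
    by rewrite pnatr_eq0.
  by rewrite mulr0 -h /P; ring.
have key u v c : c != 0 -> (forall k : 'I_6, c * P k = wedge_vec u v 0 k) ->
    exists u v : 'rV[R]_4, p = wedge_vec u v.
  move=> c0 H; exists (c^-1 *: u), v; apply/rowP => l.
  apply: (mulfI c0); rewrite pE H !mxE.
  case: l => -[|[|[|[|[|[|]]]]]] //= _; by field.
case: k k6 Pk => [|[|[|[|[|[|]]]]]] // _ Pk;
  [apply: (key r0 r1 _ Pk) | apply: (key r0 r2 _ Pk) | apply: (key r0 r3 _ Pk)
  |apply: (key r1 r2 _ Pk) | apply: (key r1 r3 _ Pk) | apply: (key r2 r3 _ Pk)];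
  (move=> l; rewrite !mxE; case: l => -[|[|[|[|[|[|]]]]]] //= _; rewrite !inordK //=; ring: h).
Qed.

(* Gr(2,4), as the Plücker quadric in P(Lambda^2 R^4); [pi] is <[pi]>. *)
Definition Gr24 : set {vspace 'rV[R]_6} :=
  [set L | exists p : bivector, [/\ p != 0, wedge p p = 0 & L = <[p]>%VS]].

Definition Gr24_atlas : set (chart R {vspace 'rV[R]_6} 4) :=
  @sub_atlas R _ 4 1 (@projective R 5) (@projective_atlas R 5) Gr24.

Definition W : set ({vspace 'rV[R]_6} * {vspace 'rV[R]_6}) :=
  [set L | (Gr24 `*` Gr24) L /\
     exists p1 p2 : bivector, [/\ p1 != 0, p2 != 0, L = (<[p1]>%VS, <[p2]>%VS)
                                & wedge p1 p2 = 0]].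

Definition Gr24_diagonal : set ({vspace 'rV[R]_6} * {vspace 'rV[R]_6}) :=
  [set L | exists2 K, Gr24 K & L = (K, K)].

End Bivectors.

(* Main.v *)
Require Import Defs.
From mathcomp Require Import all_boot all_order all_algebra.
From mathcomp Require Import all_classical all_reals all_analysis.
From mathcomp Require Import perm ring.

Set Implicit Arguments.
Unset Strict Implicit.
Unset Printing Implicit Defensive.

Import Order.TTheory GRing.Theory Num.Theory.
Import numFieldNormedType.Exports.

Local Open Scope classical_set_scope.
Local Open Scope ring_scope.

(** Around a point with p_i != 0, normalised by p_i = 1, the equation
   p /\ p = 0 is affine in the coordinate p_i' that the wedge form pairs with
   p_i (i' is [rev_ord i]), with constant nonzero slope.  So p /\ p may replace
   p_i' among the affine coordinates of P^5: this is a slice chart of the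
   quadric ([quadric_chart_slice]), and the quadric is parametrised by the
   remaining four coordinates ([quadric_param]).

   In a product of two such charts, around ([p], [q]) with p_i = 1, the
   incidence function p /\ q is again affine in each of the eight coordinates,
   because p depends on each of its four coordinates in an affine way
   ([quadric_param_shift]).  The slope in the direction of the coordinate p_k
   is, up to sign, q_k' - p_k' q_i ([wedge_quadric_partial]).  If all these
   slopes vanish, then q - q_i p is a multiple of the basis vector e_i', and its
   wedge with p is zero, which forces q = q_i p ([isotropic_span]): the point
   is on the diagonal.  Away from the diagonal some slope is nonzero, and p /\ q
   may replace the corresponding coordinate.

   Both uses are instances of [straight_chart_slice]: a function that is affine
   in one coordinate, with a slope that does not involve this coordinate, can be
   exchanged for it wherever the slope is nonzero, and the inverse
   coordinate change is explicit.

   The rest is general: the calculus of C^k maps (products, inverses and the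
   chain rule), the compatibility of any two charts of a maximal atlas
   ([maximal_atlas_compatible]), and the atlases induced on an embedded
   submanifold ([sub_atlas_smooth]) and on a product ([prod_atlas_smooth]). *)

(** * Scalar functions of class C^k *)

(** Differentiability depends only on the germ: the differential of f is still
    a first order approximation of g, and such an approximation is unique. *)
Lemma near_eq_differentiable (R : realType) (V V' : normedModType R)
    (f g : V -> V') (x : V) :
  (\near x, f x = g x) -> differentiable f x -> differentiable g x.
Proof.
move=> fg df; have fgx : f x = g x by exact: nbhs_singleton fg.
have cdf : continuous ('d f x) by exact: diff_continuous.
have E : g \o shift x = cst (g x) + 'd f x +o_ 0 id.
  apply/eqaddoP => e e0.
  have /diff_locally/eqaddoP/(_ e e0) H := df.
  have fg0 : \forall h \near (0 : V), f (h + x) = g (h + x).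
    by have := fg; rewrite (near_shift 0) /=; apply: filterS => y /=; rewrite subr0.
  apply: filterS2 fg0 H => y e1 /=; rewrite !fctE /= e1 fgx.
  by apply.
by apply/diff_locallyP; rewrite (diff_unique cdf E).
Qed.

Section ScalarCalculus.
Variables (R : realType) (m : nat).
Implicit Types (U : set 'rV[R]_m) (f g : 'rV[R]_m -> R).

(** The recursion is that of [class_C], for real values: products and inverses
    make sense there, and [class_C_coordsP] brings the results back to maps with
    vector values. *)
Fixpoint scalar_C k U f : Prop :=
  match k with
  | 0 => forall x, U x -> {for x, continuous f}
  | k'.+1 => (forall x, U x -> differentiable f x) /\
             (forall v : 'rV[R]_m, scalar_C k' U ('D_v f))
  end.

Definition scalar_smooth U f : Prop := forall k, scalar_C k U f.

Lemma near_of_open U (P : 'rV[R]_m -> Prop) x :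
  open U -> U x -> (forall y, U y -> P y) -> \near x, P x.
Proof.
by move=> oU Ux UP; apply: filterS UP _; apply: open_nbhs_nbhs.
Qed.

(** Maps between charts are known only on an open set, so all constructions
    below are up to equality there. *)
Lemma scalar_C_eq k U f g :
  open U -> (forall x, U x -> f x = g x) -> scalar_C k U f -> scalar_C k U g.
Proof.
move=> oU; elim: k f g => [|k IH] f g fg /=.
  move=> cf x Ux; have nfg := near_of_open oU Ux fg.
  by apply: cvg_trans (near_eq_cvg nfg) _; rewrite -(fg _ Ux); exact: cf.
move=> [df Df]; split=> [x Ux|v].
  by apply: near_eq_differentiable (df _ Ux); exact: (near_of_open oU Ux fg).
apply: IH (Df v) => x Ux; apply: near_eq_derive; exact: (near_of_open oU Ux fg).
Qed.

Lemma scalar_C_sub k U U' f : U' `<=` U -> scalar_C k U f -> scalar_C k U' f.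
Proof.
move=> sU; elim: k f => [|k IH] f /=; first by move=> cf x /sU; exact: cf.
by move=> [df Df]; split=> [x /sU|v]; [exact: df|exact: IH].
Qed.

Lemma scalar_C_pred k U f : scalar_C k.+1 U f -> scalar_C k U f.
Proof.
elim: k f => [|k IH] f [df Df] /=.
  by move=> x /df; exact: differentiable_continuous.
by split=> // v; exact: IH.
Qed.

Lemma scalar_C_cst k U (a : R) : scalar_C k U (fun=> a).
Proof.
elim: k a => [|k IH] a /=; first by move=> x _; exact: cst_continuous.
split=> [x _|v]; first exact: differentiable_cst.
have -> : 'D_v (fun=> a) = (fun=> 0) :> ('rV[R]_m -> R).
  by apply/funext => x; rewrite derive_cst.
exact: IH.
Qed.

Lemma scalar_C_coord k U (j : 'I_m) : scalar_C k U (fun x => x 0 j).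
Proof.
have df (x : 'rV[R]_m) : differentiable (fun x : 'rV[R]_m => x 0 j : R) x.
  exact: differentiable_coord.
case: k => [|k] /=; first by move=> x _; exact: differentiable_continuous.
split=> // v; suff -> : 'D_v (fun x : 'rV[R]_m => x 0 j : R) = (fun=> v 0 j).
  exact: scalar_C_cst.
apply/funext => x; have := derive_mx (@derivable_id _ _ x v).
by rewrite derive_id => /rowP/(_ j); rewrite mxE => ->.
Qed.

Lemma scalar_C_add k U f g :
  open U -> scalar_C k U f -> scalar_C k U g -> scalar_C k U (fun x => f x + g x).
Proof.
move=> oU; elim: k f g => [|k IH] f g /=.
  move=> cf cg x Ux; exact: (continuousD (cf x Ux) (cg x Ux)).
move=> [df Df] [dg Dg]; split=> [x Ux|v].
  by apply: differentiableD; [exact: df|exact: dg].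
apply: scalar_C_eq (IH _ _ (Df v) (Dg v)) => // x Ux.
by rewrite deriveD //; apply: diff_derivable; [exact: df|exact: dg].
Qed.

(** Leibniz rule: the induction on k needs f and g themselves to be of class C^k,
    which is why [scalar_C_pred] comes first. *)
Lemma scalar_C_mul k U f g :
  open U -> scalar_C k U f -> scalar_C k U g -> scalar_C k U (fun x => f x * g x).
Proof.
move=> oU; elim: k f g => [|k IH] f g.
  by move=> cf cg x Ux; exact: (continuousM (cf x Ux) (cg x Ux)).
move=> Cf Cg; have [cf cg] := (scalar_C_pred Cf, scalar_C_pred Cg).
case: Cf Cg => [df Df] [dg Dg]; split=> [x Ux|v].
  by apply: differentiableM; [exact: df|exact: dg].
apply: scalar_C_eq (scalar_C_add oU (IH _ _ cf (Dg v)) (IH _ _ cg (Df v))) => //.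
by move=> x Ux; rewrite deriveM //; apply: diff_derivable; [exact: df|exact: dg].
Qed.

(** The derivative of 1/f is - (1/f)(1/f) D_v f, in which 1/f is of class C^k by
    induction. *)
Lemma scalar_C_inv k U f :
  open U -> (forall x, U x -> f x != 0) -> scalar_C k U f ->
  scalar_C k U (fun x => (f x)^-1).
Proof.
move=> oU f0; elim: k => [|k IH].
  by move=> cf x Ux; exact: (continuousV (f0 x Ux) (cf x Ux)).
move=> Cf; have /IH cV := scalar_C_pred Cf.
case: Cf => df Df; split=> [x Ux|v].
  by apply: differentiableV; [exact: df|exact: f0].
have cM := scalar_C_mul oU (scalar_C_mul oU cV cV)
  (scalar_C_mul oU (scalar_C_cst _ _ (-1)) (Df v)).
apply: scalar_C_eq cM => // x Ux.
rewrite deriveV ?f0 //; last by apply: diff_derivable; exact: df.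
by rewrite -exprVn expr2 /GRing.scale /=; ring.
Qed.

Lemma scalar_C_sum k U (I : Type) (r : seq I) (F : I -> 'rV[R]_m -> R) :
  open U -> (forall i, scalar_C k U (F i)) ->
  scalar_C k U (fun x => \sum_(i <- r) F i x).
Proof.
move=> oU CF; elim: r => [|i r IH].
  by apply: scalar_C_eq (scalar_C_cst k U 0) => // x _; rewrite big_nil.
apply: scalar_C_eq (scalar_C_add oU (CF i) IH) => // x _.
by rewrite big_cons.
Qed.

Lemma differentiable_coordsP n (f : 'rV[R]_m -> 'rV[R]_n) x :
  differentiable f x <-> forall j, differentiable (fun y => f y 0 j) x.
Proof.
split=> [df j|df].
  exact: (differentiable_comp df (differentiable_coord (f x) 0 j)).
have -> : f = \sum_j (fun y => f y 0 j *: delta_mx 0 j : 'rV[R]_n).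
  apply/funext => y; rewrite fct_sumE; exact: row_sum_delta.
apply: differentiable_sum => j; exact: differentiableZl.
Qed.

Lemma class_C_coordsP k U n (f : 'rV[R]_m -> 'rV[R]_n) :
  open U -> class_C k U f <-> forall j, scalar_C k U (fun x => f x 0 j).
Proof.
move=> oU; elim: k f => [|k IH] f /=.
  split=> [cf j x Ux|cf x Ux].
    exact: (continuous_comp (cf _ Ux) (@coord_continuous _ _ _ 0 j (f x))).
  move=> A [P nP sPA]; pose Q j : set 'rV[R]_m := [set y | P 0 j (f y 0 j)].
  have nQ j : nbhs x (Q j) by apply: (cf j x Ux); exact: nP.
  (* A neighbourhood in the space of rows contains a product of
     neighbourhoods, and there are finitely many coordinates. *)
  suff : nbhs x (f @^-1` A) by [].
  apply: (filterS _ (filter_forall _ nQ)) => y Qy; apply: sPA => i j.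
  by rewrite ord1; exact: Qy.
have DE : (forall x, U x -> differentiable f x) ->
    forall v j x, U x -> 'D_v f x 0 j = 'D_v (fun y => f y 0 j) x.
  by move=> df v j x /df/diff_derivable fv; rewrite derive_mx // mxE.
split=> [[df Df] j|H].
  split=> [x /df/differentiable_coordsP //|v].
  by apply: scalar_C_eq ((IH _).1 (Df v) j) => //; exact: DE.
have df x : U x -> differentiable f x.
  by move=> Ux; apply/differentiable_coordsP => j; have [+ _] := H j; apply.
split=> // v; apply/IH => j; have [_ Df] := H j.
by apply: scalar_C_eq (Df v) => // x Ux; rewrite DE.
Qed.

End ScalarCalculus.

(** * Smooth maps between row vector spaces *)

Section SmoothMaps.
Variable R : realType.

(** Chain rule in coordinates: a form in which the derivative of g o f is a sum
    of products, to which the induction of [scalar_C_comp] applies. *)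
Lemma derive_comp_coords m n (f : 'rV[R]_m -> 'rV[R]_n) (g : 'rV[R]_n -> R) x v :
  differentiable f x -> differentiable g (f x) ->
  'D_v (fun y => g (f y)) x =
    \sum_j 'D_v (fun y => f y 0 j) x * 'D_(delta_mx 0 j) g (f x).
Proof.
move=> df dg; have dgf : differentiable (g \o f) x by exact: differentiable_comp.
rewrite -[LHS]/('D_v (g \o f) x) deriveE // diff_comp //= -(deriveE v df).
rewrite {1}['D_v f x]row_sum_delta linear_sum; apply: eq_bigr => j _.
rewrite linearZ /= -deriveE //; congr (_ * _).
by rewrite derive_mx ?mxE //; exact: diff_derivable.
Qed.

Lemma scalar_C_comp m n k (U : set 'rV[R]_m) (V : set 'rV[R]_n)
    (f : 'rV[R]_m -> 'rV[R]_n) (g : 'rV[R]_n -> R) :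
  open U -> (forall x, U x -> V (f x)) -> class_C k U f -> scalar_C k V g ->
  scalar_C k U (fun x => g (f x)).
Proof.
move=> oU UV; elim: k g => [|k IH] g.
  move=> cf cg x Ux; exact: (continuous_comp (cf x Ux) (cg _ (UV x Ux))).
move=> /(class_C_coordsP k.+1 _ oU) Cf [dg Dg].
have df x : U x -> differentiable f x.
  by move=> Ux; apply/differentiable_coordsP => j; have [+ _] := Cf j; apply.
split=> [x Ux|v].
  exact: (differentiable_comp (df x Ux) (dg _ (UV x Ux))).
have Cfk : class_C k U f by apply/class_C_coordsP => // j; exact: scalar_C_pred.
have H j : scalar_C k U
    (fun x => 'D_v (fun y => f y 0 j) x * 'D_(delta_mx 0 j) g (f x)).
  by apply: scalar_C_mul => //; [have [_ D] := Cf j; exact: (D v) | exact: (IH _ Cfk (Dg _))].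
apply: scalar_C_eq (scalar_C_sum _ oU H) => // x Ux.
by rewrite derive_comp_coords //; [exact: df | apply: dg; exact: UV].
Qed.

Lemma smooth_onP m n (U : set 'rV[R]_m) (f : 'rV[R]_m -> 'rV[R]_n) :
  open U -> smooth_on U f <-> forall j, scalar_smooth U (fun x => f x 0 j).
Proof.
move=> oU; split=> [sf j k|sf k]; first by apply/class_C_coordsP: j.
by apply/class_C_coordsP => // j; exact: sf.
Qed.

Lemma scalar_smooth_comp m n (U : set 'rV[R]_m) (V : set 'rV[R]_n)
    (f : 'rV[R]_m -> 'rV[R]_n) (g : 'rV[R]_n -> R) :
  open U -> (forall x, U x -> V (f x)) -> smooth_on U f -> scalar_smooth V g ->
  scalar_smooth U (fun x => g (f x)).
Proof. by move=> oU UV sf sg k; exact: (scalar_C_comp oU UV). Qed.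

Lemma smooth_on_comp m n p (U : set 'rV[R]_m) (V : set 'rV[R]_n)
    (f : 'rV[R]_m -> 'rV[R]_n) (g : 'rV[R]_n -> 'rV[R]_p) :
  open U -> open V -> (forall x, U x -> V (f x)) ->
  smooth_on U f -> smooth_on V g -> smooth_on U (g \o f).
Proof.
move=> oU oV UV sf /smooth_onP sg; apply/smooth_onP => // j.
exact: (scalar_smooth_comp oU UV sf (sg oV j)).
Qed.

Lemma smooth_on_eq m n (U : set 'rV[R]_m) (f g : 'rV[R]_m -> 'rV[R]_n) :
  open U -> (forall x, U x -> f x = g x) -> smooth_on U f -> smooth_on U g.
Proof.
move=> oU fg /smooth_onP sf; apply/smooth_onP => // j k.
by apply: scalar_C_eq (sf oU j k) => // x Ux; rewrite fg.
Qed.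

(** Every clause of [class_C] is a condition at each point separately. *)
Lemma smooth_on_local m n (U : set 'rV[R]_m) (f : 'rV[R]_m -> 'rV[R]_n) :
  (forall x, U x -> exists2 N, N x & smooth_on N f) -> smooth_on U f.
Proof.
move=> H k; elim: k f H => [|k IH] f H /=.
  by move=> x /H[N Nx /(_ 0%N)]; apply.
split=> [x /H[N Nx /(_ 1%N)[+ _]]|v]; first exact.
by apply: IH => x /H[N Nx sf]; exists N => // l; have [_] := sf l.+1; apply.
Qed.

Lemma smooth_on_sub m n (U U' : set 'rV[R]_m) (f : 'rV[R]_m -> 'rV[R]_n) :
  U' `<=` U -> smooth_on U f -> smooth_on U' f.
Proof. by move=> sU sf; apply: smooth_on_local => x /sU Ux; exists U. Qed.

Lemma smooth_on_open m n (U : set 'rV[R]_m) (V : set 'rV[R]_n)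
    (f : 'rV[R]_m -> 'rV[R]_n) :
  open U -> open V -> smooth_on U f -> open (U `&` f @^-1` V).
Proof.
move=> oU oV sf; rewrite openE => x [Ux Vfx].
have nU : nbhs x U by exact: open_nbhs_nbhs.
have nV : nbhs x (f @^-1` V).
  by apply: (sf 0%N x Ux); exact: open_nbhs_nbhs.
exact: filterI.
Qed.

Lemma smooth_on_lsubmx m n U : open U -> smooth_on U (@lsubmx R 1 m n).
Proof.
move=> oU; apply/smooth_onP => // j k.
by apply: scalar_C_eq (scalar_C_coord k U (lshift n j)) => // x _; rewrite mxE.
Qed.

Lemma smooth_on_rsubmx m n U : open U -> smooth_on U (@rsubmx R 1 m n).
Proof.
move=> oU; apply/smooth_onP => // j k.
by apply: scalar_C_eq (scalar_C_coord k U (rshift m j)) => // x _; rewrite mxE.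
Qed.

Lemma smooth_onD m n (U : set 'rV[R]_m) (f g : 'rV[R]_m -> 'rV[R]_n) :
  open U -> smooth_on U f -> smooth_on U g -> smooth_on U (fun x => f x + g x).
Proof.
move=> oU /(smooth_onP _ oU) sf /(smooth_onP _ oU) sg; apply/smooth_onP => // j k.
by apply: scalar_C_eq (scalar_C_add oU (sf j k) (sg j k)) => // x _; rewrite mxE.
Qed.

Lemma smooth_onZl m n (U : set 'rV[R]_m) (g : 'rV[R]_m -> R) (v : 'rV[R]_n) :
  open U -> scalar_smooth U g -> smooth_on U (fun x => g x *: v).
Proof.
move=> oU sg; apply/smooth_onP => // j k.
apply: scalar_C_eq (scalar_C_mul oU (sg k) (scalar_C_cst k U (v 0 j))) => // x _.
by rewrite mxE.
Qed.

Lemma smooth_on_row_mx p m n (U : set 'rV[R]_p) (f : 'rV[R]_p -> 'rV[R]_m)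
    (g : 'rV[R]_p -> 'rV[R]_n) :
  open U -> smooth_on U f -> smooth_on U g ->
  smooth_on U (fun x => row_mx (f x) (g x)).
Proof.
move=> oU /smooth_onP sf /smooth_onP sg; apply/smooth_onP => // j k.
case: (splitP j) => [i|i] ji.
  have -> : j = lshift n i by exact: val_inj.
  by apply: scalar_C_eq (sf oU i k) => // x _; rewrite row_mxEl.
have -> : j = rshift m i by exact: val_inj.
by apply: scalar_C_eq (sg oU i k) => // x _; rewrite row_mxEr.
Qed.

Lemma open_neq0 m (g : 'rV[R]_m -> R) : scalar_smooth setT g ->
  open [set x | g x != 0].
Proof.
move=> sg; apply: (@open_comp _ _ g [set t | t != 0]).
  by move=> x _; exact: (sg 0%N x I).
exact: open_neq.
Qed.

Lemma smooth_on_continuous m n (f : 'rV[R]_m -> 'rV[R]_n) :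
  smooth_on setT f -> continuous f.
Proof. by move=> sf x; exact: (sf 0%N x I). Qed.

Lemma smooth_on_cst m n (U : set 'rV[R]_m) (a : 'rV[R]_n) :
  open U -> smooth_on U (fun=> a).
Proof. by move=> oU; apply/smooth_onP => // j k; exact: scalar_C_cst. Qed.

Lemma smooth_on_id m (U : set 'rV[R]_m) : open U -> smooth_on U id.
Proof. by move=> oU; apply/smooth_onP => // j k; exact: scalar_C_coord. Qed.

End SmoothMaps.

(** * Transitions between charts and the maximal atlas *)

Section Atlases.
Variables (R : realType) (T : Type) (n : nat).
Implicit Types (M : set T) (A : set (chart R T n)) (c a : chart R T n).

(** A transition map given locally is given globally: injectivity of the first
    chart makes the value at a point independent of the local formula chosen. *)
Lemma smooth_transition_local c c' :
  (forall p, (cdom c `&` cdom c') p -> exists N g,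
    [/\ open N, N (cmap c p), N `<=` cmap c @` (cdom c `&` cdom c'),
        smooth_on N g
      & forall q, (cdom c `&` cdom c') q -> N (cmap c q) ->
          cmap c' q = g (cmap c q)]) ->
  {in cdom c &, injective (cmap c)} ->
  smooth_transition c c'.
Proof.
set U := cdom c `&` cdom c' => H injc; split.
  rewrite openE => _ [p Up <-]; have [N [g [oN Np sN _ _]]] := H p Up.
  by apply: filterS sN _; apply: open_nbhs_nbhs.
have [g gE] : exists g : 'rV[R]_n -> 'rV[R]_n,
    forall p, U p -> cmap c' p = g (cmap c p).
  have P y : exists z, forall p, U p -> cmap c p = y -> cmap c' p = z.
    have [[p Up <-]|nU] := pselect (exists2 p, U p & cmap c p = y).
      exists (cmap c' p) => q Uq /injc -> //; apply/mem_set; [exact: Uq.1|exact: Up.1].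
    by exists 0 => p Up py; case: nU; exists p.
  have [g gP] := choice P.
  by exists g => p Up; exact: gP.
exists g; split=> //; apply: smooth_on_local => _ [p Up <-].
have [N [gp [oN Np sN sgp gpE]]] := H p Up; exists N => //.
apply: smooth_on_eq sgp => // y Ny; have [q Uq qy] := sN y Ny.
by rewrite -qy -gE // gpE // qy.
Qed.

(** Compatibility is not transitive, since two charts compatible with a third one
    may meet outside of its domain; it becomes so when charts such as the middle
    one cover the overlap. *)
Lemma smooth_transition_trans c c' :
  {in cdom c &, injective (cmap c)} ->
  (forall p, (cdom c `&` cdom c') p -> exists a,
    [/\ cdom a p, {in cdom a &, injective (cmap a)},
        smooth_transition c a & smooth_transition a c']) ->
  smooth_transition c c'.
Proof.
move=> injc H; apply: smooth_transition_local => // p [cp c'p].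
have [a [ap inja [ o1 [g1 [s1 g1E]]] [ o2 [g2 [s2 g2E]]]]] := H p (conj cp c'p).
(* The part of the image of c where the composite g2 o g1 is defined. *)
pose N := cmap c @` (cdom c `&` cdom a) `&`
  g1 @^-1` (cmap a @` (cdom a `&` cdom c')).
(* Injectivity of c and of a turns conditions on coordinates into conditions
   on points. *)
have NE q : cdom c q -> N (cmap c q) -> cdom a q /\ cdom c' q.
  move=> cq [[q1 [cq1 aq1] E1] [q2 [aq2 c2q2] E2]].
  have E : q1 = q by apply: injc => //; exact/mem_set.
  subst q1.
  rewrite -g1E // in E2.
  by rewrite (inja _ _ _ _ (esym E2)) //; exact/mem_set.
have oN : open N by exact: smooth_on_open.
exists N, (g2 \o g1); split => //.
- by split; [exists p | rewrite /= -g1E //; exists p].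
- move=> y Ny; have [[q [cq _] qy] _] := Ny.
  by rewrite -qy in Ny *; exists q => //; split=> //; have [] := NE q cq Ny.
- apply: (smooth_on_comp oN o2 _ _ s2) => [y []//|].
  by apply: smooth_on_sub s1 => y [].
- move=> q [cq c'q] Nq; have [aq _] := NE q cq Nq.
  by rewrite /= -g1E // -g2E.
Qed.

Lemma sub_maximal_atlas M A : smooth_atlas M A -> A `<=` maximal_atlas M A.
Proof. by move=> [chA _ cA] c Ac; split; [exact: chA | move=> c'; exact: cA]. Qed.

Lemma maximal_atlas_compatible M A c c' :
  smooth_atlas M A -> maximal_atlas M A c -> maximal_atlas M A c' ->
  compatible c c'.
Proof.
move=> [chA covA cA].
suff H c1 c2 : maximal_atlas M A c1 -> maximal_atlas M A c2 ->
    smooth_transition c1 c2 by move=> mc mc'; split; exact: H.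
move=> [[sc1 ic1 oc1] H1] [_ H2]; apply: smooth_transition_trans => // p [/sc1 Mp _].
have [a Aa ap] := covA p Mp; have [_ ia _] := chA a Aa.
by exists a; split=> //; [have [] := H1 a Aa | have [] := H2 a Aa].
Qed.

(** A local change of coordinates phi, with inverse psi, keeps a chart in the
    maximal atlas. *)
Lemma maximal_atlas_change M A c0 (V V' : set 'rV[R]_n)
    (phi psi : 'rV[R]_n -> 'rV[R]_n) :
  smooth_atlas M A -> maximal_atlas M A c0 ->
  open V -> open V' -> smooth_on V phi -> smooth_on V' psi ->
  (forall x, V x -> V' (phi x)) -> (forall y, V' y -> V (psi y)) ->
  (forall x, V x -> psi (phi x) = x) -> (forall y, V' y -> phi (psi y) = y) ->
  maximal_atlas M A (Chart (cdom c0 `&` cmap c0 @^-1` V) (phi \o cmap c0)).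
Proof.
move=> sA [[sc0 ic0 oc0] H0] oV oV' sphi spsi phiV psiV phiK psiK.
set c := Chart _ _.
have ic : {in cdom c &, injective (cmap c)}.
  move=> p q /set_mem[/= cp Vp] /set_mem[/= cq Vq] /(congr1 psi).
  by rewrite !phiK //; apply: ic0; exact/mem_set.
have imE : cmap c @` cdom c = V' `&` psi @^-1` (cmap c0 @` cdom c0).
  apply/seteqP; split=> [_ [p [/= cp Vp] <-]|y [V'y [p cp pE]]] /=.
    by split; [exact: phiV | exists p => //; rewrite phiK].
  exists p; first by split=> //=; rewrite pE; exact: psiV.
  by rewrite /= pE psiK.
have oim : open (cmap c @` cdom c) by rewrite imE; exact: smooth_on_open.
have c0c : smooth_transition c0 c.
  split.
    rewrite (_ : _ @` _ = cmap c0 @` cdom c0 `&` V); first exact: openI.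
    apply/seteqP; split=> [_ [p [cp [_ /= Vp]] <-]|_ [[p cp <-] Vp]].
      by split=> //; exists p.
    by exists p.
  exists phi; split=> //.
  by apply: smooth_on_sub sphi => _ [p [cp [_ Vp]] <-].
have cc0 : smooth_transition c c0.
  have -> : smooth_transition c c0 = (open (cmap c @` cdom c) /\
    exists g : 'rV[R]_n -> 'rV[R]_n, smooth_on (cmap c @` cdom c) g /\
      forall p, cdom c p -> cmap c0 p = g (cmap c p)).
    by rewrite /smooth_transition setIAC setIid.
  split=> //; exists psi; split; first by apply: smooth_on_sub spsi; rewrite imE.
  by move=> p [cp Vp]; rewrite /= phiK.
split; first by split=> // p [/sc0].
move=> a Aa; have [chA _ _] := sA; have [_ ia _] := chA a Aa.
have [c0a ac0] := H0 a Aa.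
split; apply: smooth_transition_trans => // p [].
  by move=> [cp Vp] ap; exists c0.
by move=> ap [cp Vp]; exists c0.
Qed.

End Atlases.

(** * Submanifolds and products carry smooth atlases *)

Section SubAtlas.
Variables (R : realType) (T : Type) (d k : nat).
Implicit Types (M S : set T) (A : set (chart R T (d + k))).

Lemma slice_chart_mem M A S c p :
  slice_chart M A S c -> cdom c p -> S p <-> rsubmx (cmap c p) = 0.
Proof.
move=> [[[_ ic _] _] E] cp; split=> [Sp|rp].
  by have [] : (cmap c @` cdom c `&` [set x | rsubmx x = 0]) (cmap c p)
    by rewrite -E; exists p.
have [q [cq Sq] qp] : (cmap c @` (cdom c `&` S)) (cmap c p).
  by rewrite E; split=> //; exists p.
by rewrite -(ic q p _ _ qp) //; exact/mem_set.
Qed.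

Let inc : 'rV[R]_d -> 'rV[R]_(d + k) := fun y => row_mx y 0.

Lemma smooth_on_inc U : open U -> smooth_on U inc.
Proof.
by move=> oU; apply: smooth_on_row_mx => //; [exact: smooth_on_id | exact: smooth_on_cst].
Qed.

Lemma open_inc U : open U -> open (inc @^-1` U).
Proof.
move=> oU; apply: open_comp => // x _; apply: smooth_on_continuous.
by apply: smooth_on_inc; exact: openT.
Qed.

Lemma slice_chart_inc M A S c p : slice_chart M A S c -> cdom c p -> S p ->
  inc (lsubmx (cmap c p)) = cmap c p.
Proof.
move=> sc cp Sp; rewrite -[RHS]hsubmxK /inc.
by congr row_mx; apply/esym/(slice_chart_mem sc cp).
Qed.

(** The transitions of the induced charts are those of the ambient slice charts,
    restricted to the slice: y |-> (y, 0), then the ambient transition, then the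
    first d coordinates. *)
Lemma sub_atlas_smooth M A S :
  embedded_submanifold M A S -> smooth_atlas S (sub_atlas M A S).
Proof.
move=> [sA sSM covS].
have imE c D : slice_chart M A S c -> D `<=` cdom c ->
    (fun p => lsubmx (cmap c p)) @` (D `&` S) = inc @^-1` (cmap c @` D).
  move=> sc Dc; apply/seteqP; split=> [_ [p [Dp Sp] <-]|y [p Dp pE]] /=.
    by exists p => //; rewrite (slice_chart_inc sc) //; exact: Dc.
  exists p; last by rewrite pE row_mxKl.
  by split=> //; apply/(slice_chart_mem sc); rewrite ?pE ?row_mxKr //; exact: Dc.
have opn c : slice_chart M A S c -> open (cmap c @` cdom c) by case=> [[[]]].
split.
- move=> _ [c sc <-]; split=> /=.
  + by move=> p [].
  + have [[[_ ic _] _] _] := sc.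
    move=> p q /set_mem[cp Sp] /set_mem[cq Sq] /(congr1 inc).
    by rewrite !(slice_chart_inc sc) //; apply: ic; exact/mem_set.
  + by rewrite imE //; apply: open_inc; exact: opn.
- move=> p /[dup] Sp /covS[c sc cp].
  by exists (Chart (cdom c `&` S) (fun p => lsubmx (cmap c p))) => //; exists c.
- suff H c c' : slice_chart M A S c -> slice_chart M A S c' ->
    smooth_transition (Chart (cdom c `&` S) (fun p => lsubmx (cmap c p)))
                      (Chart (cdom c' `&` S) (fun p => lsubmx (cmap c' p))).
    by move=> _ _ [c sc <-] [c' sc' <-]; split; exact: H.
  move=> sc sc'.
  have [[oU [g [sg gE]]] _] := maximal_atlas_compatible sA sc.1 sc'.1.
  have imD := imE c (cdom c `&` cdom c') sc (fun p Dp => Dp.1).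
  rewrite /smooth_transition /= setIACA setIid imD.
  have oV := open_inc oU; split=> //; exists (lsubmx \o g \o inc); split.
    apply: (smooth_on_comp oV oU) => //; first exact: smooth_on_inc.
    apply: (smooth_on_comp oU openT) => //.
    exact: (smooth_on_lsubmx openT).
  move=> p [[cp Sp] [c'p _]] /=.
  by rewrite (slice_chart_inc sc) // -gE.
Qed.

End SubAtlas.

Section ProdAtlas.
Variables (R : realType) (T1 T2 : Type) (m n : nat).

Lemma prod_chart_image (c1 : chart R T1 m) (c2 : chart R T2 n) D1 D2 :
  cmap (prod_chart c1 c2) @` (D1 `*` D2) =
  lsubmx @^-1` (cmap c1 @` D1) `&` rsubmx @^-1` (cmap c2 @` D2).
Proof.
apply/seteqP; split=> [_ [[p q] [/= D1p D2q] <-]|z [[p D1p pE] [q D2q qE]]] /=.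
  by rewrite row_mxKl row_mxKr; split; [exists p | exists q].
by exists (p, q) => //=; rewrite pE qE hsubmxK.
Qed.

Lemma open_prod_image (U1 : set 'rV[R]_m) (U2 : set 'rV[R]_n) :
  open U1 -> open U2 ->
  open ((lsubmx : 'rV[R]_(m + n) -> _) @^-1` U1 `&`
        (rsubmx : 'rV[R]_(m + n) -> _) @^-1` U2).
Proof.
move=> o1 o2; apply: openI; apply: open_comp => // x _.
  exact: continuous_lsubmx.
exact: continuous_rsubmx.
Qed.

Lemma smooth_transition_prod (c1 c1' : chart R T1 m) (c2 c2' : chart R T2 n) :
  smooth_transition c1 c1' -> smooth_transition c2 c2' ->
  smooth_transition (prod_chart c1 c2) (prod_chart c1' c2').
Proof.
move=> [ o1 [g1 [s1 g1E]]] [ o2 [g2 [s2 g2E]]].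
rewrite /smooth_transition /= -setXI prod_chart_image.
have oU := open_prod_image o1 o2; split=> //.
exists (fun z => row_mx (g1 (lsubmx z)) (g2 (rsubmx z))); split.
  apply: smooth_on_row_mx => //.
    by apply: (smooth_on_comp oU o1 _ (smooth_on_lsubmx oU)) => // z [].
  by apply: (smooth_on_comp oU o2 _ (smooth_on_rsubmx oU)) => // z [].
move=> [p q] [[/= c1p c2q] [/= c1'p c2'q]] /=.
by rewrite row_mxKl row_mxKr g1E // g2E.
Qed.

Lemma prod_atlas_smooth (M1 : set T1) (M2 : set T2)
    (A1 : set (chart R T1 m)) (A2 : set (chart R T2 n)) :
  smooth_atlas M1 A1 -> smooth_atlas M2 A2 ->
  smooth_atlas (M1 `*` M2) (prod_atlas A1 A2).
Proof.
move=> [ch1 cov1 co1] [ch2 cov2 co2]; split.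
- move=> _ [c1 [c2 [/ch1[s1 i1 o1] /ch2[s2 i2 o2] ->]]]; split.
  + by move=> [p q] [/= /s1 ? /s2 ?].
  + move=> [p q] [p' q'] /set_mem[/= cp cq] /set_mem[/= cp' cq'] /eq_row_mx[].
    move=> e1 e2; congr pair.
      by apply: i1 e1; exact/mem_set.
    by apply: i2 e2; exact/mem_set.
  + by rewrite prod_chart_image; exact: open_prod_image.
- move=> [p q] [/= /cov1[c1 A1c1 c1p] /cov2[c2 A2c2 c2q]].
  by exists (prod_chart c1 c2) => //; exists c1, c2.
- move=> _ _ [c1 [c2 [A1c1 A2c2 ->]]] [c1' [c2' [A1c1' A2c2' ->]]].
  have [t1 t1'] := co1 _ _ A1c1 A1c1'; have [t2 t2'] := co2 _ _ A2c2 A2c2'.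
  by split; exact: smooth_transition_prod.
Qed.

End ProdAtlas.

(** * Exchanging a coordinate for a function affine in it *)

Section SliceFromFunction.
Variables (R : realType) (T : Type) (d : nat).
Variables (M S : set T) (A : set (chart R T (d + 1))) (c0 : chart R T (d + 1)).
Variables (a : 'I_(d + 1)) (f f' : 'rV[R]_(d + 1) -> R).

Definition swap_last (x : 'rV[R]_(d + 1)) : 'rV[R]_(d + 1) :=
  col_perm (tperm a (rshift d ord0)) x.

(** The change of coordinates that discards the coordinate a and puts the value
    of f last. *)
Definition straighten (x : 'rV[R]_(d + 1)) : 'rV[R]_(d + 1) :=
  row_mx (lsubmx (swap_last x)) (f x)%:M.

(** The point with given coordinates other than a, and with coordinate a zero. *)
Definition straighten_base (y : 'rV[R]_d) : 'rV[R]_(d + 1) :=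
  swap_last (row_mx y 0).

(** Recovers the coordinate t along e_a from the last coordinate of y, which is
    f (x + t e_a) = f x + t f' x. *)
Definition unstraighten (y : 'rV[R]_(d + 1)) : 'rV[R]_(d + 1) :=
  let x := straighten_base (lsubmx y) in
  x + ((rsubmx y 0 0 - f x) / f' x) *: delta_mx 0 a.

Definition straight_chart : chart R T (d + 1) :=
  Chart (cdom c0 `&` cmap c0 @^-1` [set x | f' x != 0]) (straighten \o cmap c0).

Let ilast : 'I_(d + 1) := rshift d ord0.

(** The transposition of a and the last index identifies the indices other than
    a with the first d ones. *)
Lemma rest_indexP (j : 'I_(d + 1)) :
  j != a -> exists i, j = tperm a ilast (lshift 1 i).
Proof.
move=> ja; case: (splitP (tperm a ilast j)) => i ji.
  by exists i; rewrite -[lshift 1 i](_ : tperm a ilast j = _) ?tpermK //; exact: val_inj.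
case/eqP: ja; apply: (@perm_inj _ (tperm a ilast)); rewrite tpermL.
by apply: val_inj; rewrite /= ji ord1.
Qed.

Lemma rest_index_neq i : tperm a ilast (lshift 1 i) != a.
Proof.
apply/eqP => /(congr1 (tperm a ilast)); rewrite tpermK tpermL => /eqP.
by rewrite eq_lrshift.
Qed.

Lemma straighten_base_a y : straighten_base y 0 a = 0.
Proof. by rewrite mxE tpermL row_mxEr mxE. Qed.

Lemma straighten_base_rest y i :
  straighten_base y 0 (tperm a ilast (lshift 1 i)) = y 0 i.
Proof. by rewrite mxE tpermK row_mxEl. Qed.

Lemma straighten_baseD y t b :
  straighten_base (y + t *: delta_mx 0 b) =
  straighten_base y + t *: delta_mx 0 (tperm a ilast (lshift 1 b)).
Proof.
apply/rowP => j; rewrite [RHS]mxE [X in _ = _ + X]mxE [delta_mx _ _ _ _]mxE.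
have [->|/rest_indexP[i ->]] := eqVneq j a.
  by rewrite !straighten_base_a eq_sym (negPf (rest_index_neq b)) andbF mulr0 addr0.
by rewrite !straighten_base_rest !mxE (inj_eq perm_inj) (inj_eq (@lshift_inj _ _)).
Qed.

Lemma straighten_base_decomp x :
  straighten_base (lsubmx (swap_last x)) = x - x 0 a *: delta_mx 0 a.
Proof.
apply/rowP => j; have [->|/rest_indexP[i ->]] := eqVneq j a.
  by rewrite straighten_base_a !mxE !eqxx mulr1 subrr.
rewrite straighten_base_rest /swap_last !mxE.
by rewrite (negPf (rest_index_neq i)) andbF mulr0 subr0.
Qed.

Lemma swap_last_base y t :
  lsubmx (swap_last (straighten_base y + t *: delta_mx 0 a)) = y.
Proof.
apply/rowP => i; rewrite 2!mxE mxE straighten_base_rest !mxE.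
by rewrite (negPf (rest_index_neq i)) andbF mulr0 addr0.
Qed.

Lemma smooth_on_straighten_base : smooth_on setT straighten_base.
Proof.
apply/smooth_onP => [|j k]; first exact: openT.
have [->|/rest_indexP[i ->]] := eqVneq j a.
  apply: scalar_C_eq (scalar_C_cst k setT 0) => [|x _]; first exact: openT.
  by rewrite straighten_base_a.
apply: scalar_C_eq (scalar_C_coord k setT i) => [|x _]; first exact: openT.
by rewrite straighten_base_rest.
Qed.

Hypotheses (sf : scalar_smooth setT f) (sf' : scalar_smooth setT f').
Hypothesis f_affine : forall x t, f (x + t *: delta_mx 0 a) = f x + t * f' x.
Hypothesis f'_inv : forall x t, f' (x + t *: delta_mx 0 a) = f' x.

Lemma straightenK x : f' x != 0 -> unstraighten (straighten x) = x.
Proof.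
move=> f'x; rewrite /unstraighten /straighten row_mxKl row_mxKr mxE eqxx mulr1n.
rewrite straighten_base_decomp -scaleNr f_affine f'_inv.
rewrite (_ : f x - _ = x 0 a * f' x); last by ring.
by rewrite mulfK // scaleNr subrK.
Qed.

Lemma unstraightenK y : f' (straighten_base (lsubmx y)) != 0 ->
  straighten (unstraighten y) = y.
Proof.
move=> f'y; rewrite /straighten /unstraighten swap_last_base f_affine.
rewrite divfK // addrC subrK -[RHS]hsubmxK; congr row_mx.
by apply/rowP => j; rewrite ord1 mxE eqxx mulr1n.
Qed.

Let V := [set x | f' x != 0].
Let V' := [set y : 'rV[R]_(d + 1) | f' (straighten_base (lsubmx y)) != 0].

Lemma smooth_base_lsubmx :
  smooth_on setT (fun y : 'rV[R]_(d + 1) => straighten_base (lsubmx y)).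
Proof.
apply: (smooth_on_comp openT openT _ _ smooth_on_straighten_base) => //.
exact: (smooth_on_lsubmx openT).
Qed.

Lemma straight_chart_maximal :
  smooth_atlas M A -> maximal_atlas M A c0 -> maximal_atlas M A straight_chart.
Proof.
move=> sA mc0.
have sb h : scalar_smooth setT h -> scalar_smooth setT
    (fun y : 'rV[R]_(d + 1) => h (straighten_base (lsubmx y))).
  exact: scalar_smooth_comp openT _ smooth_base_lsubmx.
have oV : open V by exact: open_neq0.
have oV' : open V' by apply: open_neq0; exact: sb.
apply: (maximal_atlas_change (V' := V') (psi := unstraighten)) => //.
- apply: smooth_on_row_mx => //.
    apply: (smooth_on_comp oV openT _ _ (smooth_on_lsubmx openT)) => //.
    by apply/smooth_onP => // j k;
      apply: scalar_C_eq (scalar_C_coord k V (tperm a ilast j)) => // x _; rewrite mxE.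
  apply/smooth_onP => // j k; apply: scalar_C_eq (scalar_C_sub _ (sf k)) => //.
  by move=> x _; rewrite ord1 mxE eqxx mulr1n.
- apply/smooth_onP => // j k.
  have sub h : scalar_smooth setT h -> scalar_C k V' h.
    by move=> sh; exact: scalar_C_sub (sh k).
  have sx : scalar_C k V' (fun y => straighten_base (lsubmx y) 0 j).
    by apply: sub; exact: (smooth_onP _ openT).1 smooth_base_lsubmx j.
  have st : scalar_C k V' (fun y => (rsubmx y 0 0 - f (straighten_base (lsubmx y)))
      / f' (straighten_base (lsubmx y))).
    apply: scalar_C_mul => //; last by apply: scalar_C_inv => //; apply: sub; exact: sb.
    apply: scalar_C_add => //.
      apply: scalar_C_eq (scalar_C_coord k V' ilast) => // y _.
      by rewrite mxE.
    apply: scalar_C_eq (scalar_C_mul oV' (scalar_C_cst k V' (-1)) (sub _ (sb _ sf))) => // y _.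
    by rewrite mulN1r.
  apply: scalar_C_eq (scalar_C_add oV' sx (scalar_C_mul oV' st
    (scalar_C_cst k V' ((delta_mx 0 a : 'rV[R]_(d + 1)) 0 j)))) => // y _.
  by rewrite /unstraighten [RHS]mxE [X in _ = _ + X]mxE.
- move=> x Vx; rewrite /V' /= /straighten row_mxKl straighten_base_decomp.
  by rewrite -scaleNr f'_inv.
- by move=> y V'y; rewrite /V /= /unstraighten f'_inv.
- by move=> x; exact: straightenK.
- by move=> y; exact: unstraightenK.
Qed.

(** A function f that is affine in the coordinate a, with slope f', can be
    exchanged for it where f' is nonzero; then {f = 0} is a slice. *)
Lemma straight_chart_slice :
  smooth_atlas M A -> maximal_atlas M A c0 ->
  (forall p, cdom c0 p -> f' (cmap c0 p) != 0 -> S p <-> f (cmap c0 p) = 0) ->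
  slice_chart M A S straight_chart.
Proof.
move=> sA mc0 SE; split; first exact: straight_chart_maximal.
have rE p : rsubmx (straighten (cmap c0 p)) = (f (cmap c0 p))%:M :> 'rV_1.
  by rewrite /straighten row_mxKr.
apply/seteqP; split=> [_ [p [[/= cp f'p] Sp] <-]|_ [[p [/= cp f'p] <-] /= r0]].
  split; first by exists p.
  by rewrite /= rE ((SE p cp f'p).1 Sp) raddf0.
exists p => //; split=> //; apply/SE => //.
by move/rowP: r0 => /(_ 0); rewrite rE !mxE eqxx mulr1n.
Qed.

End SliceFromFunction.

(** * The affine charts of projective space *)

Section ProjectiveAtlas.
Variables (R : realType) (n : nat).
Implicit Types (i : 'I_n.+1) (x : 'rV[R]_n) (v : 'rV[R]_n.+1).

Lemma line_eqP v w : v != 0 -> <[v]>%VS = <[w]>%VS -> exists t, w = t *: v.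
Proof. by move=> v0 E; apply/vlineP; rewrite E memv_line. Qed.

Lemma lineZ t v : t != 0 -> <[t *: v]>%VS = <[v]>%VS.
Proof.
move=> t0; apply/eqP; rewrite eqEsubv -!memvE memvZ ?memv_line //=.
by rewrite -{1}[v](scalerK t0) memvZ ?memv_line.
Qed.

Lemma projectiveP L : projective L -> exists2 v : 'rV[R]_n.+1, v != 0 & L = <[v]>%VS.
Proof.
move=> L1; have v0 : vpick L != 0 by rewrite vpick0 -dimv_eq0 L1.
exists (vpick L) => //; apply/eqP; rewrite eq_sym eqEdim -memvE memv_pick /=.
by rewrite L1 dim_vline v0.
Qed.

(** The normalised representative, with coordinate i equal to 1, of the line with
    affine coordinates x. *)
Definition homogenize i x : 'rV[R]_n.+1 :=
  \row_k (if unlift i k is Some j then x 0 j else 1).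

Lemma homogenize_pivot i x : homogenize i x 0 i = 1.
Proof. by rewrite mxE unlift_none. Qed.

Lemma homogenize_lift i x j : homogenize i x 0 (lift i j) = x 0 j.
Proof. by rewrite mxE liftK. Qed.

Lemma homogenize_neq0 i x : homogenize i x != 0.
Proof.
by apply/eqP => /rowP/(_ i); rewrite homogenize_pivot mxE; apply/eqP/oner_neq0.
Qed.

Lemma homogenizeD i x t j :
  homogenize i (x + t *: delta_mx 0 j) =
  homogenize i x + t *: delta_mx 0 (lift i j).
Proof.
apply/rowP => k; rewrite !mxE; case: (unliftP i k) => [l ->|->]; rewrite ?mxE.
  by rewrite (inj_eq lift_inj).
by rewrite (negPf (neq_lift _ _)) andbF mulr0 addr0.
Qed.

Lemma homogenize_affine i v : v 0 i != 0 ->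
  homogenize i (\row_j (v 0 (lift i j) / v 0 i)) = (v 0 i)^-1 *: v.
Proof.
move=> vi; apply/rowP => k; rewrite !mxE.
by case: (unliftP i k) => [l ->|->]; rewrite ?mxE ?mulVf // mulrC.
Qed.

Lemma affine_chartK i L : cdom (affine_chart R i) L ->
  <[homogenize i (cmap (affine_chart R i) L)]>%VS = L.
Proof.
move=> /[dup][[/projectiveP[v v0 ->] _]] /(affine_chart_dom _ v0) vi.
by rewrite affine_chart_map // homogenize_affine // lineZ // invr_neq0.
Qed.

Lemma homogenizeK i x :
  cdom (affine_chart R i) <[homogenize i x]>%VS /\
  cmap (affine_chart R i) <[homogenize i x]>%VS = x.
Proof.
have h0 := homogenize_neq0 i x; split.
  by apply/affine_chart_dom; rewrite // homogenize_pivot oner_neq0.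
rewrite affine_chart_map //; apply/rowP => j.
by rewrite mxE homogenize_lift homogenize_pivot divr1.
Qed.

Lemma smooth_on_homogenize i (U : set 'rV[R]_n) :
  open U -> smooth_on U (homogenize i).
Proof.
move=> oU; apply/smooth_onP => // k l; case: (unliftP i k) => [j ->|->].
  apply: scalar_C_eq (scalar_C_coord l U j) => // x _.
  by rewrite homogenize_lift.
apply: scalar_C_eq (scalar_C_cst l U 1) => // x _.
by rewrite homogenize_pivot.
Qed.

(** All transitions factor through [homogenize], a smooth section of the
    projection from vectors to lines, so they are quotients of its coordinates. *)
Lemma projective_atlas_smooth : smooth_atlas (@projective R n) (@projective_atlas R n).
Proof.
have imE i (j : 'I_n.+1) : cmap (affine_chart R i) @`
    (cdom (affine_chart R i) `&` cdom (affine_chart R j)) =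
    [set x | homogenize i x 0 j != 0].
  apply/seteqP; split=> [_ [L [Li Lj] <-]|x hj].
    rewrite /= -(affine_chart_dom _ (homogenize_neq0 _ _)).
    by rewrite affine_chartK.
  have [Li Lx] := homogenizeK i x; exists <[homogenize i x]>%VS => //.
  by split=> //; apply/affine_chart_dom; rewrite ?homogenize_neq0.
have oim i (j : 'I_n.+1) : open [set x | homogenize i x 0 j != 0].
  apply: open_neq0.
  exact: (smooth_onP _ openT).1 (smooth_on_homogenize i openT) j.
split.
- move=> _ [i _ <-]; split.
  + by move=> L [].
  + move=> L K /set_mem/affine_chartK LE /set_mem/affine_chartK KE E.
    by rewrite -LE -KE E.
  + by rewrite -[X in _ @` X]setIid imE.
- move=> L PL; have [v v0 ->] := projectiveP PL.
  have /rV0Pn[i vi] := v0; exists (affine_chart R i); first by exists i.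
  exact/affine_chart_dom.
- suff H i (j : 'I_n.+1) : smooth_transition (affine_chart R i) (affine_chart R j).
    by move=> _ _ [i _ <-] [j _ <-]; split; exact: H.
  rewrite /smooth_transition imE; split=> //.
  exists (fun x => \row_k (homogenize i x 0 (lift j k) / homogenize i x 0 j)).
  split.
    have sh k : scalar_smooth [set x | homogenize i x 0 j != 0]
        (fun x => homogenize i x 0 k).
      exact: (smooth_onP _ (oim i j)).1 (smooth_on_homogenize i (oim i j)) k.
    apply/smooth_onP => // k l.
    apply: scalar_C_eq (scalar_C_mul (oim i j) (sh (lift j k) l)
      (scalar_C_inv (oim i j) _ (sh j l))) => // x _.
    by rewrite [RHS]mxE.
  move=> L [Li Lj]; rewrite -{1}(affine_chartK Li).
  by rewrite affine_chart_map // homogenize_neq0.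
Qed.

End ProjectiveAtlas.

(** * The Pluecker quadric and its charts *)

Section WedgeForm.
Variable R : realType.
Implicit Types (p q : bivector R) (i k : 'I_6).

(** The signs in the expression of [wedge] as a sum of p_k q_(5-k): the index
    paired with k is [rev_ord k]. *)
Definition wedge_sign k : R := nth 0 [:: 1; -1; 1; 1; -1; 1] k.

Lemma wedge_signK k : wedge_sign k * wedge_sign k = 1.
Proof. by rewrite /wedge_sign; case: k => -[|[|[|[|[|[|]]]]]] //= _; ring. Qed.

Lemma wedge_sign_neq0 k : wedge_sign k != 0.
Proof.
apply/eqP => s0.
by have := wedge_signK k; rewrite s0 mul0r => /eqP; rewrite eq_sym oner_eq0.
Qed.

Lemma double_wedge_sign_neq0 k : 2 * wedge_sign k != 0.
Proof. by rewrite mulf_neq0 ?pnatr_eq0 ?wedge_sign_neq0. Qed.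

Lemma wedge_sign_rev k : wedge_sign (rev_ord k) = wedge_sign k.
Proof. by rewrite /wedge_sign; case: k => -[|[|[|[|[|[|]]]]]]. Qed.

Lemma rev_ord6_neq k : (rev_ord k == k) = false.
Proof. by case: k => -[|[|[|[|[|[|]]]]]]. Qed.

Lemma wedgeE p q : wedge p q = \sum_k wedge_sign k * (p 0 k * q 0 (rev_ord k)).
Proof.
rewrite (eq_bigr (fun k : 'I_6 =>
  wedge_sign k * (p 0 (inord k) * q 0 (inord (6 - k.+1))))) => [|k _].
  by rewrite !big_ord_recl big_ord0 /wedge_sign /= /wedge; ring.
by rewrite inord_val -{1}[rev_ord k]inord_val.
Qed.

Lemma wedgeC p q : wedge p q = wedge q p.
Proof. by rewrite /wedge; ring. Qed.

Lemma wedgeDr p q r : wedge p (q + r) = wedge p q + wedge p r.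
Proof. by rewrite /wedge !mxE; ring. Qed.

Lemma wedgeZr t p q : wedge p (t *: q) = t * wedge p q.
Proof. by rewrite /wedge !mxE; ring. Qed.

Lemma wedgeDl p q r : wedge (p + q) r = wedge p r + wedge q r.
Proof. by rewrite !(wedgeC _ r) wedgeDr. Qed.

Lemma wedgeZl t p q : wedge (t *: p) q = t * wedge p q.
Proof. by rewrite !(wedgeC _ q) wedgeZr. Qed.

Lemma wedge_delta p k : wedge p (delta_mx 0 k) = wedge_sign k * p 0 (rev_ord k).
Proof.
rewrite wedgeE (bigD1 (rev_ord k)) //= big1 ?addr0 => [|l lk].
  by rewrite rev_ordK mxE !eqxx mulr1 wedge_sign_rev.
rewrite mxE eqxx /= (_ : (rev_ord l == k) = false) ?mulr0 //.
by apply/negbTE; apply: contra_neq lk => <-; rewrite rev_ordK.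
Qed.

Lemma wedge_delta_delta k : wedge (delta_mx 0 k) (delta_mx 0 k) = 0 :> R.
Proof. by rewrite wedge_delta mxE rev_ord6_neq andbF mulr0. Qed.

Lemma scalar_smooth_wedge m (U : set 'rV[R]_m) (f g : 'rV[R]_m -> bivector R) :
  open U -> smooth_on U f -> smooth_on U g ->
  scalar_smooth U (fun x => wedge (f x) (g x)).
Proof.
move=> oU /(smooth_onP _ oU) sf /(smooth_onP _ oU) sg l.
pose F k x := wedge_sign k * (f x 0 k * g x 0 (rev_ord k)).
have sF k : scalar_C l U (F k).
  apply: scalar_C_mul => //; first exact: scalar_C_cst.
  by apply: scalar_C_mul; [|exact: sf|exact: sg].
by apply: scalar_C_eq (scalar_C_sum (index_enum _) oU sF) => // x _; rewrite wedgeE.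
Qed.

Lemma Gr24_line p : p != 0 -> Gr24 <[p]>%VS <-> wedge p p = 0.
Proof.
move=> p0; split=> [[q [q0 qq E]]|pp]; last by exists p.
have [t ->] := line_eqP q0 (esym E); by rewrite wedgeZl wedgeZr qq !mulr0.
Qed.

End WedgeForm.

Section GrassmannianCharts.
Variables (R : realType) (i : 'I_6).

Let s := wedge_sign R i.

(** The position, among the affine coordinates of the chart i, of the coordinate
    paired with i. *)
Definition opp_index : 'I_5 := odflt ord0 (unlift i (rev_ord i)).

Lemma lift_opp_index : lift i opp_index = rev_ord i.
Proof.
rewrite /opp_index; case: unliftP => [j -> //|E].
by have := rev_ord6_neq i; rewrite {1}E eqxx.
Qed.

Let quad (x : 'rV[R]_(4 + 1)) : R := wedge (homogenize i x) (homogenize i x).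
Let quad' (x : 'rV[R]_(4 + 1)) : R := 2 * s.

Definition quadric_chart : chart R {vspace 'rV[R]_6} (4 + 1) :=
  @straight_chart R _ 4 (affine_chart R i) opp_index quad quad'.

(** The quadratic term vanishes because basis bivectors are isotropic, and the
    slope is constant because e_i' is paired with the coordinate i only, which
    is normalised to 1. *)
Lemma quad_affine x t : quad (x + t *: delta_mx 0 opp_index) = quad x + t * quad' x.
Proof.
rewrite /quad homogenizeD lift_opp_index !(wedgeDl, wedgeDr, wedgeZl, wedgeZr).
rewrite wedge_delta_delta (wedgeC (delta_mx _ _)) wedge_delta.
rewrite wedge_sign_rev rev_ordK homogenize_pivot -/s /quad'; ring.
Qed.

(** Its domain is all of the affine chart, since the slope is a nonzero constant. *)
Lemma quadric_chart_slice :
  @slice_chart R _ 4 1 (@projective R 5) (@projective_atlas R 5) (@Gr24 R) quadric_chart.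
Proof.
have sA := projective_atlas_smooth R 5.
apply: straight_chart_slice => //.
- exact: (scalar_smooth_wedge openT (smooth_on_homogenize i openT) (smooth_on_homogenize i openT)).
- by move=> k; exact: scalar_C_cst.
- exact: quad_affine.
- by apply: (sub_maximal_atlas sA); exists i.
- move=> L Li _; rewrite -{1}(affine_chartK Li).
  exact: Gr24_line (homogenize_neq0 _ _).
Qed.

(** The four indices of bivector coordinates that serve as coordinates on the
    quadric. *)
Definition quadric_index (b : 'I_4) : 'I_6 :=
  lift i (tperm opp_index (rshift 4 ord0) (lshift 1 b)).

Lemma quadric_index_neq b : quadric_index b != i /\ quadric_index b != rev_ord i.
Proof.
rewrite eq_sym neq_lift; split=> //.
by rewrite -lift_opp_index (inj_eq lift_inj) (@rest_index_neq 4 opp_index b).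
Qed.

Lemma quadric_indexP k : k != i -> k != rev_ord i -> exists b, k = quadric_index b.
Proof.
move=> ki kr; case: (unliftP i k) => [j E|/eqP]; last by rewrite (negPf ki).
have ja : j != opp_index by apply: contra_neq kr => ja; rewrite E ja lift_opp_index.
have [b jb] := @rest_indexP 4 opp_index j ja.
by exists b; rewrite E jb.
Qed.

Let base (y : 'rV[R]_4) : bivector R :=
  homogenize i (@straighten_base R 4 opp_index y).

(** The unique isotropic bivector with coordinate i equal to 1 and the given
    coordinates at [quadric_index]: the coefficient of e_i' is determined by
    p /\ p = 0. *)
Definition quadric_param (y : 'rV[R]_4) : bivector R :=
  base y + (- (s / 2) * wedge (base y) (base y)) *: delta_mx 0 (rev_ord i).

(** The partial derivative of [quadric_param] in the direction b. *)
Definition quadric_partial (b : 'I_4) (y : 'rV[R]_4) : bivector R :=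
  let u := delta_mx 0 (quadric_index b) in
  u + (- s * wedge (base y) u) *: delta_mx 0 (rev_ord i).

Lemma wedge_pivot p : wedge p (delta_mx 0 (rev_ord i)) = s * p 0 i.
Proof. by rewrite wedge_delta wedge_sign_rev rev_ordK. Qed.

Lemma quadric_param_pivot y : quadric_param y 0 i = 1.
Proof.
by rewrite mxE homogenize_pivot !mxE eq_sym rev_ord6_neq andbF mulr0 addr0.
Qed.

Lemma quadric_param_isotropic y : wedge (quadric_param y) (quadric_param y) = 0.
Proof.
have ss := wedge_signK R i; rewrite -/s in ss.
rewrite !(wedgeDl, wedgeDr, wedgeZl, wedgeZr) wedge_delta_delta.
rewrite (wedgeC (delta_mx _ _)) wedge_pivot homogenize_pivot.
by field: ss.
Qed.

Lemma base_shift y t b :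
  base (y + t *: delta_mx 0 b) = base y + t *: delta_mx 0 (quadric_index b).
Proof.
rewrite /base -homogenizeD; congr homogenize.
exact: (@straighten_baseD R 4 opp_index).
Qed.

(** [quadric_param] is quadratic, but the coefficient of t^2 is the wedge of a
    basis bivector with itself, which is zero. *)
Lemma quadric_param_shift y t b :
  quadric_param (y + t *: delta_mx 0 b) = quadric_param y + t *: quadric_partial b y.
Proof.
rewrite /quadric_param /quadric_partial base_shift.
rewrite !(wedgeDl, wedgeDr, wedgeZl, wedgeZr) wedge_delta_delta.
rewrite (wedgeC (delta_mx _ _)).
rewrite scalerDr scalerA [RHS]addrACA -scalerDl; congr (_ + _ *: _).
by field.
Qed.

Lemma quadric_partial_shift y t b :
  quadric_partial b (y + t *: delta_mx 0 b) = quadric_partial b y.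
Proof.
by rewrite /quadric_partial base_shift wedgeDl wedgeZl wedge_delta_delta mulr0 addr0.
Qed.

(** The slope of the incidence function in the direction b, up to sign a minor
    of the matrix with rows p and q, as p_i = 1. *)
Lemma wedge_quadric_partial y b q :
  wedge (quadric_partial b y) q =
  wedge_sign R (quadric_index b) * (q 0 (rev_ord (quadric_index b))
    - quadric_param y 0 (rev_ord (quadric_index b)) * q 0 i).
Proof.
have ss := wedge_signK R i; rewrite -/s in ss.
have [ki kr] := quadric_index_neq b; set k := quadric_index b in ki kr *.
rewrite wedgeDl wedgeZl (wedgeC (delta_mx 0 (rev_ord i))) wedge_pivot.
rewrite (wedgeC (delta_mx 0 k)) !wedge_delta.
have -> : quadric_param y 0 (rev_ord k) = base y 0 (rev_ord k).
  rewrite /quadric_param mxE [X in _ + X]mxE [delta_mx _ _ _ _]mxE.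
  by rewrite (inj_eq rev_ord_inj) (negPf ki) andbF mulr0 addr0.
by ring: ss.
Qed.

Lemma smooth_on_base U : open U -> smooth_on U base.
Proof.
move=> oU; apply: (smooth_on_comp oU openT) (smooth_on_homogenize i openT) => //.
by apply: smooth_on_sub (@smooth_on_straighten_base R 4 opp_index).
Qed.

Lemma smooth_on_quadric_param U : open U -> smooth_on U quadric_param.
Proof.
move=> oU; apply: smooth_onD (smooth_on_base oU) _ => //.
apply: smooth_onZl => // k; apply: scalar_C_mul => //; first exact: scalar_C_cst.
exact: (scalar_smooth_wedge oU (smooth_on_base oU) (smooth_on_base oU)).
Qed.

Lemma smooth_on_quadric_partial U b : open U -> smooth_on U (quadric_partial b).
Proof.
move=> oU; apply: smooth_onD => //; first exact: smooth_on_cst.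
apply: smooth_onZl => // k; apply: scalar_C_mul => //; first exact: scalar_C_cst.
by apply: (scalar_smooth_wedge oU (smooth_on_base oU)); exact: smooth_on_cst.
Qed.

Definition Gr24_chart : chart R {vspace 'rV[R]_6} 4 :=
  Chart (cdom quadric_chart `&` @Gr24 R) (fun L => lsubmx (cmap quadric_chart L)).

Lemma Gr24_chart_atlas : Gr24_atlas Gr24_chart.
Proof. by exists quadric_chart => //; exact: quadric_chart_slice. Qed.

(** On the quadric, the last coordinate of [quadric_chart] is zero, so that the
    four others determine the point. *)
Lemma Gr24_chartK L : cdom Gr24_chart L ->
  <[quadric_param (cmap Gr24_chart L)]>%VS = L.
Proof.
move=> [[Li _] GL]; rewrite -[RHS](affine_chartK Li).
rewrite /= row_mxKl; congr (<[_]>%VS).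
set x := cmap (affine_chart R i) L.
have ss := wedge_signK R i; rewrite -/s in ss.
have w0 : wedge (homogenize i x) (homogenize i x) = 0.
  by apply/(Gr24_line (homogenize_neq0 _ _)); rewrite affine_chartK.
rewrite /quadric_param /base straighten_base_decomp -scaleNr homogenizeD.
rewrite lift_opp_index !(wedgeDl, wedgeDr, wedgeZl, wedgeZr) wedge_delta_delta w0.
rewrite (wedgeC (delta_mx _ _)) wedge_pivot homogenize_pivot.
rewrite -addrA -scalerDl [X in X *: _](_ : _ = 0) ?scale0r ?addr0 //.
by field: ss.
Qed.

End GrassmannianCharts.

(** * The incidence hypersurface *)

Lemma Gr24_embedded (R : realType) :
  @embedded_submanifold R _ 4 1 (@projective R 5) (@projective_atlas R 5) (@Gr24 R).
Proof.
split=> [|L [p [p0 _ ->]]|L [p [p0 pp ->]]].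
- exact: projective_atlas_smooth.
- by rewrite /projective /= dim_vline p0.
- have /rV0Pn[i pi] := p0; exists (quadric_chart R i).
    exact: quadric_chart_slice.
  by split; [exact/affine_chart_dom | exact: double_wedge_sign_neq0].
Qed.

Section Incidence.
Variable R : realType.
Implicit Types (i j : 'I_6) (b : 'I_4).

Lemma Gr24_chart_cover (L : {vspace 'rV[R]_6}) :
  Gr24 L -> exists i, cdom (Gr24_chart R i) L.
Proof.
move=> /[dup] GL [p [p0 pp LE]]; have /rV0Pn[i pi] := p0; exists i.
by split=> //; split; [rewrite LE; exact/affine_chart_dom | exact: double_wedge_sign_neq0].
Qed.

Lemma W_line (p q : bivector R) : p != 0 -> q != 0 ->
  wedge p p = 0 -> wedge q q = 0 ->
  W (<[p]>%VS, <[q]>%VS) <-> wedge p q = 0.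
Proof.
move=> p0 q0 pp qq; split=> [[_ [p1 [q1 [p10 q10 LE w0]]]]|pq].
  have [t ->] := line_eqP p10 (congr1 fst (esym LE)).
  have [u ->] := line_eqP q10 (congr1 snd (esym LE)).
  by rewrite wedgeZl wedgeZr w0 !mulr0.
by split; [split; exact/Gr24_line | exists p, q].
Qed.

Lemma quadric_param_neq0 i y : @quadric_param R i y != 0.
Proof.
apply/eqP => /rowP/(_ i); rewrite quadric_param_pivot mxE.
by apply/eqP/oner_neq0.
Qed.

(** The difference q - q_i p has all coordinates zero except the one paired with
    i, on which wedging with p is faithful. *)
Lemma isotropic_span i (p q : bivector R) :
  p 0 i = 1 -> wedge p p = 0 -> wedge p q = 0 ->
  (forall b, q 0 (rev_ord (quadric_index i b)) =
             p 0 (rev_ord (quadric_index i b)) * q 0 i) ->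
  q = q 0 i *: p.
Proof.
move=> pi pp pq H; pose r := q - q 0 i *: p.
have rE : r = r 0 (rev_ord i) *: delta_mx 0 (rev_ord i).
  apply/rowP => k; rewrite [RHS]mxE [delta_mx _ _ _ _]mxE eqxx.
  have [->|kr] := eqVneq k (rev_ord i); first by rewrite mulr1.
  rewrite mulr0 /r !mxE.
  have [->|ki] := eqVneq k i; first by rewrite pi mulr1 subrr.
  have rki : rev_ord k != i by apply: contra_neq kr => <-; rewrite rev_ordK.
  have rkr : rev_ord k != rev_ord i by rewrite (inj_eq rev_ord_inj).
  have [b kb] := quadric_indexP rki rkr.
  by rewrite -[k]rev_ordK kb H mulrC subrr.
(* The wedge of p with r is, up to sign, p_i = 1 times the last coordinate
   left. *)
have : wedge p r = 0 by rewrite /r wedgeDr -scaleNr wedgeZr pp pq mulr0 addr0.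
rewrite rE wedgeZr wedge_pivot pi mulr1 => /eqP.
rewrite mulf_eq0 (negPf (wedge_sign_neq0 R i)) orbF => /eqP r0.
by move: rE; rewrite r0 scale0r => /eqP; rewrite subr_eq0 => /eqP.
Qed.

Variables (i j : 'I_6) (b : 'I_4).

Let incidence (z : 'rV[R]_(7 + 1)) : R :=
  wedge (quadric_param i (lsubmx (z : 'rV[R]_(4 + 4))))
        (quadric_param j (rsubmx (z : 'rV[R]_(4 + 4)))).

Let incidence' (z : 'rV[R]_(7 + 1)) : R :=
  wedge (quadric_partial i b (lsubmx (z : 'rV[R]_(4 + 4))))
        (quadric_param j (rsubmx (z : 'rV[R]_(4 + 4)))).

Definition Gr24_prod_chart : chart R ({vspace 'rV[R]_6} * {vspace 'rV[R]_6}) (4 + 4) :=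
  prod_chart (Gr24_chart R i) (Gr24_chart R j).

Definition incidence_chart : chart R ({vspace 'rV[R]_6} * {vspace 'rV[R]_6}) (7 + 1) :=
  @straight_chart R _ 7 Gr24_prod_chart (lshift 4 b : 'I_(4 + 4)) incidence incidence'.

Lemma block_delta (z : 'rV[R]_(4 + 4)) t :
  lsubmx (z + t *: delta_mx 0 (lshift 4 b)) = lsubmx z + t *: delta_mx 0 b /\
  rsubmx (z + t *: delta_mx 0 (lshift 4 b)) = rsubmx z.
Proof.
split; apply/rowP => k; rewrite !mxE.
  by rewrite (inj_eq (@lshift_inj _ _)).
by rewrite eq_rlshift andbF mulr0 addr0.
Qed.

(** The slope of the incidence function is zero on the diagonal, so this chart
    avoids it; in its domain, incidence alone cuts out the submanifold. *)
Lemma incidence_chart_slice :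
  @slice_chart R _ 7 1 (@Gr24 R `*` @Gr24 R)
    (prod_atlas (@Gr24_atlas R) (@Gr24_atlas R)) (@W R `\` @Gr24_diagonal R)
    incidence_chart.
Proof.
have sG : smooth_atlas (@Gr24 R) (@Gr24_atlas R).
  exact: sub_atlas_smooth (Gr24_embedded R).
have sA := prod_atlas_smooth sG sG.
have sparam k : smooth_on setT (@quadric_param R k).
  exact: smooth_on_quadric_param openT.
have oT4 := @openT 'rV[R]_4; have oT8 := @openT 'rV[R]_(4 + 4).
have sl := @smooth_on_lsubmx R 4 4 setT openT.
have sr := @smooth_on_rsubmx R 4 4 setT openT.
apply: (@straight_chart_slice R _ 7) => //.
- apply: (@scalar_smooth_wedge R (4 + 4)) => //.
    exact: (smooth_on_comp oT8 oT4 _ sl).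
  exact: (smooth_on_comp oT8 oT4 _ sr).
- apply: (@scalar_smooth_wedge R (4 + 4)) => //.
    apply: (smooth_on_comp oT8 oT4 _ sl) => //.
    exact: smooth_on_quadric_partial.
  exact: (smooth_on_comp oT8 oT4 _ sr).
- move=> z t; rewrite /incidence /incidence'.
  have [-> ->] := block_delta z t.
  by rewrite quadric_param_shift wedgeDl wedgeZl.
- move=> z t; rewrite /incidence'.
  have [-> ->] := block_delta z t.
  by rewrite quadric_partial_shift.
- apply: (sub_maximal_atlas sA).
  by exists (Gr24_chart R i), (Gr24_chart R j); split=> //; exact: Gr24_chart_atlas.
- move=> [L K] [LG KG].
  pose X := quadric_param i (cmap (Gr24_chart R i) L).
  pose Y := quadric_param j (cmap (Gr24_chart R j) K).
  have -> : incidence (cmap Gr24_prod_chart (L, K)) = wedge X Y.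
    by rewrite /incidence row_mxKl row_mxKr.
  have -> : incidence' (cmap Gr24_prod_chart (L, K)) =
      wedge (quadric_partial i b (cmap (Gr24_chart R i) L)) Y.
    by rewrite /incidence' row_mxKl row_mxKr.
  rewrite wedge_quadric_partial -/X => f'0.
  have LE : L = <[X]>%VS by rewrite Gr24_chartK.
  have KE : K = <[Y]>%VS by rewrite Gr24_chartK.
  have X0 : X != 0 by exact: quadric_param_neq0.
  have Y0 : Y != 0 by exact: quadric_param_neq0.
  have XX : wedge X X = 0 by exact: quadric_param_isotropic.
  have YY : wedge Y Y = 0 by exact: quadric_param_isotropic.
  rewrite LE KE; split=> [[/(W_line X0 Y0 XX YY)] //|XY].
  split; first exact/(W_line X0 Y0 XX YY).
  (* On the diagonal Y is proportional to X, and the minor vanishes. *)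
  case=> N _ NE; have [t YE] : exists t, Y = t *: X.
    exact: line_eqP X0 (etrans (congr1 fst NE) (esym (congr1 snd NE))).
  have tX k : (t *: X) 0 k = t * X 0 k by rewrite [LHS]mxE.
  by case/eqP: f'0; rewrite YE !tX (quadric_param_pivot i); ring.
Qed.

End Incidence.

Theorem proposition5p1 (R : realType) :
  @smooth_hypersurface R _ 7 (@Gr24 R `*` @Gr24 R)
    (prod_atlas (@Gr24_atlas R) (@Gr24_atlas R))
    (@W R `\` @Gr24_diagonal R).
Proof.
have sG : smooth_atlas (@Gr24 R) (@Gr24_atlas R).
  exact: sub_atlas_smooth (Gr24_embedded R).
split; [exact: (prod_atlas_smooth sG sG) | by move=> p [[]] |].
move=> [L K] [WLK nd]; have [[/= GL GK] _] := WLK.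
have [i Li] := Gr24_chart_cover GL; have [j Kj] := Gr24_chart_cover GK.
pose X := quadric_param i (cmap (Gr24_chart R i) L).
pose Y := quadric_param j (cmap (Gr24_chart R j) K).
have LE : L = <[X]>%VS by rewrite Gr24_chartK.
have KE : K = <[Y]>%VS by rewrite Gr24_chartK.
have X0 : X != 0 by exact: quadric_param_neq0.
have Y0 : Y != 0 by exact: quadric_param_neq0.
have XX : wedge X X = 0 by exact: quadric_param_isotropic.
have YY : wedge Y Y = 0 by exact: quadric_param_isotropic.
have XY : wedge X Y = 0.
  by move: WLK; rewrite LE KE => /(W_line X0 Y0 XX YY).
have [b Hb] : exists b, Y 0 (rev_ord (quadric_index i b))
    - X 0 (rev_ord (quadric_index i b)) * Y 0 i != 0.
  apply: contrapT => nb; apply: nd; exists L => //; congr pair.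
  have YE : Y = Y 0 i *: X.
    apply: isotropic_span => // [|b]; first exact: quadric_param_pivot.
    by apply/eqP; rewrite -subr_eq0; apply: contrapT => /negP Hb; apply: nb; exists b.
  rewrite LE KE YE lineZ //; apply: contra_neq Y0 => Yi.
  by rewrite YE Yi scale0r.
exists (incidence_chart R i j b); first exact: incidence_chart_slice.
split=> //; rewrite /= row_mxKl row_mxKr.
change (wedge (quadric_partial i b (cmap (Gr24_chart R i) L)) Y != 0).
by rewrite wedge_quadric_partial mulf_neq0 // wedge_sign_neq0.
Qed.
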